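(* Let $M$ be a metric space with a distinguished point $0\in M$ which is non-isolated in $M$, let $f:M\to M$ be a Lipschitz map such that $f(0)=0$, and let $x\in M$. Then the following assertions are equivalent: (1) $x$ is a hypercyclic element for $f$, i.e. $\{f^n(x):n\ge 0\}$ is dense in $M$; (2) $\delta(x)$ is a cyclic vector for $\widehat{f}:\mathcal{F}(M)\to\mathcal{F}(M)$, i.e. $\mathrm{span}\{\widehat{f}^{\,n}(\delta(x)):n\ge0\}$ is dense in $\mathcal{F}(M)$.
   Context: For a metric space $(M,d)$ with base point $0$, $\mathrm{Lip}_0(M)$ is the real Banach space of Lipschitz functions $M\to\mathbb{R}$ vanishing at $0$, with norm the best Lipschitz constant. For $x\in M$, $\delta(x)\in \mathrm{Lip}_0(M)^*$ is the evaluation $\langle \varphi,\delta(x)\rangle=\varphi(x)$. The Lipschitz-free space is $\mathcal{F}(M)=\overline{\mathrm{span}}^{\|\cdot\|}\{\delta(x):x\in M\}\subset \mathrm{Lip}_0(M)^*$. If $f:M\to M$ is Lipschitz with $f(0)=0$, $\widehat{f}:\mathcal{F}(M)\to\mathcal{F}(M)$ is the unique bounded linear operator with $\widehat{f}(\delta(x))=\delta(f(x))$ for all $x\in M$. *)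

(* Defs.v *)
(* Lipschitz-free spaces, on top of MathComp-Analysis. *)
From HB Require Import structures.
From mathcomp Require Import all_boot all_order all_algebra.
From mathcomp Require Import all_classical all_reals all_analysis.
Import Order.TTheory GRing.Theory Num.Theory.
Import numFieldNormedType.Exports.

Set Implicit Arguments.
Unset Strict Implicit.
Unset Printing Implicit Defensive.

Local Open Scope classical_set_scope.
Local Open Scope ring_scope.

Definition lipschitz_map {R : realType} {M N : metricType R} (f : M -> N) :=
  exists K : R, forall x y, mdist (f x) (f y) <= K * mdist x y.

Definition hypercyclic_element {T : topologicalType} (f : T -> T) (x : T) :=
  dense [set iter n f x | n in [set: nat]].

(* Finite linear combinations of elements of [A]; [A] may be infinite. *)
Definition lspan {R : realType} {V : lmodType R} (A : set V) : set V :=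
  [set v | exists n (c : 'I_n -> R) (a : 'I_n -> V),
     (forall i, A (a i)) /\ v = \sum_(i < n) c i *: a i].

Definition cyclic_vector {R : realType} {V : normedModType R}
    (T : V -> V) (v : V) :=
  dense (lspan [set iter n T v | n in [set: nat]]).

Section helpers.
Context {R : realType}.

Lemma inf_bound (S : set R) (g w : R) : S !=set0 -> 0 <= w ->
  (forall K, S K -> g <= K * w) -> g <= inf S * w.
Proof.
move=> [K0 SK0]; rewrite le_eqVlt => /orP[/eqP <-|w0] H.
  by have := H _ SK0; rewrite !mulr0.
rewrite -ler_pdivrMr//; apply: lb_le_inf; first by exists K0.
by move=> K /H; rewrite ler_pdivrMr.
Qed.

Lemma inf_nneg_ge0 (S : set R) :
  S !=set0 -> (forall K, S K -> 0 <= K) -> 0 <= inf S.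
Proof. by move=> S0 H; apply: lb_le_inf. Qed.

Lemma inf_nneg_le (S : set R) K : (forall K, S K -> 0 <= K) -> S K -> inf S <= K.
Proof. by move=> H SK; apply: ge_inf => //; exists 0 => x /H. Qed.

Context {V : lmodType R}.
Implicit Type A : set V.

Lemma lspan0 A : lspan A 0.
Proof.
exists 0%N, (fun=> 0), (fun=> 0); split; first by case.
by rewrite big_ord0.
Qed.

Lemma lspanZ A (k : R) u : lspan A u -> lspan A (k *: u).
Proof.
move=> [n [c [a [Aa ->]]]]; exists n, (fun i => k * c i), a; split => //.
by rewrite scaler_sumr; apply: eq_bigr => i _; rewrite scalerA.
Qed.

Lemma lspanD A u v : lspan A u -> lspan A v -> lspan A (u + v).
Proof.
move=> [n [c [a [Aa ->]]]] [m [d [b [Ab ->]]]].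
exists (n + m)%N, (fun i : 'I_(n + m) => match fintype.split i with inl j => c j | inr j => d j end),
  (fun i : 'I_(n + m) => match fintype.split i with inl j => a j | inr j => b j end); split.
  by move=> i; case: (fintype.split i).
rewrite big_split_ord/=; congr (_ + _); apply: eq_bigr => i _.
- by rewrite (unsplitK (inl i : 'I_n + 'I_m)%type).
- by rewrite (unsplitK (inr i : 'I_n + 'I_m)%type).
Qed.

Lemma sub_lspan A : A `<=` lspan A.
Proof.
move=> v Av; exists 1%N, (fun=> 1), (fun=> v); split => //.
by rewrite big_ord_recl big_ord0 addr0 scale1r.
Qed.

End helpers.

(* Lip_0(M) for the base point [o]. *)
Section lip0.
Context {R : realType} {M : metricType R} (o : M).

(* On [R^o], [mdist x y] is [`|y - x|]. *)
Definition lip0_pred : {pred M -> R^o} :=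
  mem [set phi : M -> R^o | lipschitz_map phi /\ phi o = 0].

Record lip0 := Lip0 { lip0_val :> M -> R^o ; _ : lip0_val \in lip0_pred }.

HB.instance Definition _ := [isSub for lip0_val].
HB.instance Definition _ := [Choice of lip0 by <:].

Lemma lip0_submod_closed : submod_closed lip0_pred.
Proof.
split.
  rewrite inE; split => //; exists 0 => x y.
  by rewrite mul0r /mdist/= subrr normr0.
move=> a u v; rewrite !inE => -[[K HK] u0] [[L HL] v0]; split; last first.
  by rewrite /= !fctE u0 v0 scaler0 addr0.
exists (`|a| * K + L) => x y.
have := HK x y; have := HL x y; rewrite /mdist/= => HL' HK'.
rewrite !fctE /= opprD addrACA -scalerBr.
rewrite (le_trans (ler_normD _ _))// normrZ mulrDl lerD// -mulrA.
exact: ler_wpM2l.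
Qed.

HB.instance Definition _ :=
  GRing.isSubmodClosed.Build _ _ lip0_pred lip0_submod_closed.
HB.instance Definition _ := [SubChoice_isSubLmodule of lip0 by <:].

Definition lip0_norm (phi : lip0) : R :=
  inf [set K : R | 0 <= K /\ forall x y, `|phi x - phi y| <= K * mdist x y].

Lemma lip0P (phi : lip0) : lipschitz_map phi /\ phi o = 0.
Proof. by have := valP phi; rewrite inE. Qed.

Let consts (phi : lip0) :=
  [set K : R | 0 <= K /\ forall x y, `|phi x - phi y| <= K * mdist x y].

Let consts0 phi : consts phi !=set0.
Proof.
have [[K HK] _] := lip0P phi; exists `|K|; split => // x y.
have := HK y x; rewrite {1}/mdist/= metric_sym => /le_trans; apply.
by apply: ler_wpM2r; [exact: mdist_ge0|exact: ler_norm].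
Qed.

Lemma lip0_norm_ge0 phi : 0 <= lip0_norm phi.
Proof. by apply: inf_nneg_ge0 => [|K []//]; exact: consts0. Qed.

Lemma lip0_normP (phi : lip0) x y :
  `|phi x - phi y| <= lip0_norm phi * mdist x y.
Proof.
apply: inf_bound; [exact: consts0|exact: mdist_ge0|by move=> K []].
Qed.

Lemma lip0_norm_le (phi : lip0) K : 0 <= K ->
  (forall x y, `|phi x - phi y| <= K * mdist x y) -> lip0_norm phi <= K.
Proof. by move=> K0 H; apply: inf_nneg_le => [L []|]. Qed.

Lemma lip0_normD phi psi :
  lip0_norm (phi + psi) <= lip0_norm phi + lip0_norm psi.
Proof.
apply: lip0_norm_le => [|x y]; first by rewrite addr_ge0 ?lip0_norm_ge0.
rewrite /= !fctE opprD addrACA (le_trans (ler_normD _ _))// mulrDl.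
by rewrite lerD ?lip0_normP.
Qed.

Let lip0_normZ_le (l : R) phi : lip0_norm (l *: phi) <= `|l| * lip0_norm phi.
Proof.
apply: lip0_norm_le => [|x y]; first by rewrite mulr_ge0 ?lip0_norm_ge0.
rewrite /= !fctE -scalerBr normrZ -mulrA.
by apply: ler_wpM2l => //; exact: lip0_normP.
Qed.

Lemma lip0_normZ (l : R) phi : lip0_norm (l *: phi) = `|l| * lip0_norm phi.
Proof.
apply/eqP; rewrite eq_le lip0_normZ_le/=.
have [->|l0] := eqVneq l 0; first by rewrite normr0 mul0r lip0_norm_ge0.
rewrite -[X in lip0_norm X](_ : l^-1 *: (l *: phi) = phi); last first.
  by rewrite scalerA mulVf// scale1r.
rewrite -ler_pdivlMl ?normr_gt0//.
by rewrite (le_trans (lip0_normZ_le _ _))// normfV.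
Qed.

Lemma lip0_norm_eq0 phi : lip0_norm phi = 0 -> phi = 0.
Proof.
move=> p0; apply/val_inj/funext => x.
have [_ po] := lip0P phi.
have := lip0_normP phi x o; rewrite po p0 mul0r subr0 normr_le0 => /eqP.
exact.
Qed.

HB.instance Definition _ := Lmodule_isNormed.Build R lip0
  lip0_normD lip0_normZ lip0_norm_eq0.

End lip0.

Section dual_space.
Context {R : realType} (V : normedModType R).

Definition dual_pred : {pred V -> R^o} :=
  mem [set m : V -> R^o | linear m /\ continuous m].

Record dual_space := Dual { dual_val :> V -> R^o ; _ : dual_val \in dual_pred }.

HB.instance Definition _ := [isSub for dual_val].
HB.instance Definition _ := [Choice of dual_space by <:].

Lemma dual_submod_closed : submod_closed dual_pred.
Proof.
split.
  rewrite inE; split; last by move=> x; exact: cvg_cst.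
  by move=> a x y; rewrite [RHS]addr0 [RHS]scaler0.
move=> a u v; rewrite !inE => -[lu cu] [lv cv]; split.
  move=> b x y; rewrite !fctE /= lu lv !scalerDr !scalerA (mulrC b a).
  by rewrite addrACA.
move=> x; apply: cvgD; last exact: cv.
by apply: cvgZr; exact: cu.
Qed.

HB.instance Definition _ :=
  GRing.isSubmodClosed.Build _ _ dual_pred dual_submod_closed.
HB.instance Definition _ := [SubChoice_isSubLmodule of dual_space by <:].

Lemma dualP (m : dual_space) : linear m /\ continuous m.
Proof. by have := valP m; rewrite inE. Qed.

HB.instance Definition _ (m : dual_space) :=
  GRing.isLinear.Build R V R^o _ (dual_val m) (dualP m).1.

Definition dual_norm (m : dual_space) : R :=
  inf [set K : R | 0 <= K /\ forall v, `|m v| <= K * `|v|].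

Let consts (m : dual_space) := [set K : R | 0 <= K /\ forall v, `|m v| <= K * `|v|].

Let consts0 m : consts m !=set0.
Proof.
have : bounded_near (dual_val m) (nbhs (0 : V)).
  by apply: continuous_linear_bounded; exact: (dualP m).2.
move=> /linear_boundedP /pinfty_ex_gt0[K K0 HK].
by exists K; split => //; exact: ltW.
Qed.

Lemma dual_norm_ge0 m : 0 <= dual_norm m.
Proof. by apply: inf_nneg_ge0 => [|K []//]; exact: consts0. Qed.

Lemma dual_normP (m : dual_space) v : `|m v| <= dual_norm m * `|v|.
Proof. by apply: inf_bound => //; [exact: consts0|move=> K []]. Qed.

Lemma dual_norm_le (m : dual_space) K : 0 <= K ->
  (forall v, `|m v| <= K * `|v|) -> dual_norm m <= K.
Proof. by move=> K0 H; apply: inf_nneg_le => [L []|]. Qed.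

Lemma dual_normD m p : dual_norm (m + p) <= dual_norm m + dual_norm p.
Proof.
apply: dual_norm_le => [|v]; first by rewrite addr_ge0 ?dual_norm_ge0.
rewrite /= !fctE (le_trans (ler_normD _ _))// mulrDl.
by rewrite lerD ?dual_normP.
Qed.

Let dual_normZ_le (l : R) m : dual_norm (l *: m) <= `|l| * dual_norm m.
Proof.
apply: dual_norm_le => [|v]; first by rewrite mulr_ge0 ?dual_norm_ge0.
rewrite /= !fctE normrZ -mulrA.
by apply: ler_wpM2l => //; exact: dual_normP.
Qed.

Lemma dual_normZ (l : R) m : dual_norm (l *: m) = `|l| * dual_norm m.
Proof.
apply/eqP; rewrite eq_le dual_normZ_le/=.
have [->|l0] := eqVneq l 0; first by rewrite normr0 mul0r dual_norm_ge0.
rewrite -[X in dual_norm X](_ : l^-1 *: (l *: m) = m); last first.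
  by rewrite scalerA mulVf// scale1r.
rewrite -ler_pdivlMl ?normr_gt0//.
by rewrite (le_trans (dual_normZ_le _ _))// normfV.
Qed.

Lemma dual_norm_eq0 m : dual_norm m = 0 -> m = 0.
Proof.
move=> m0; apply/val_inj/funext => v.
by have := dual_normP m v; rewrite m0 mul0r normr_le0 => /eqP.
Qed.

HB.instance Definition _ := Lmodule_isNormed.Build R dual_space
  dual_normD dual_normZ dual_norm_eq0.

Lemma bounded_dual_pred (m : V -> R^o) (K : R) : linear m ->
  (forall v, `|m v| <= K * `|v|) -> m \in dual_pred.
Proof.
move=> lm mK; rewrite inE; split => //.
pose A := GRing.isLinear.Build R V R^o _ m lm.
pose m' : {linear V -> R^o} := HB.pack m A.
apply: (@bounded_linear_continuous _ _ _ m').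
apply/linear_boundedP; near=> r => x; apply: le_trans (mK x) _.
by apply: ler_wpM2r => //; near: r; exact: nbhs_pinfty_ge.
Unshelve. all: by end_near. Qed.

End dual_space.

(* F(M) for the base point [o], as a subspace of the dual of Lip_0(M). *)
Section lipfree.
Context {R : realType} {M : metricType R} (o : M).

Definition eval_at (x : M) : lip0 o -> R^o := fun phi => phi x.

Lemma eval_at_dual x : eval_at x \in dual_pred (V := lip0 o).
Proof.
apply: (@bounded_dual_pred _ _ _ (mdist x o)) => [a u v //|phi].
have := lip0_normP phi x o; rewrite (lip0P phi).2 subr0 mulrC.
exact.
Qed.

Definition delta_dual (x : M) : dual_space (lip0 o) := Dual (eval_at_dual x).

Definition free_pred : {pred dual_space (lip0 o)} :=
  mem (closure (lspan (range delta_dual))).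

Record lipfree := Free { free_val :> dual_space (lip0 o) ; _ : free_val \in free_pred }.

HB.instance Definition _ := [isSub for free_val].
HB.instance Definition _ := [Choice of lipfree by <:].

Lemma free_approx (m : dual_space (lip0 o)) : m \in free_pred <->
  forall e : R, 0 < e ->
    exists2 s, lspan (range delta_dual) s & `|m - s| < e.
Proof.
rewrite inE; split.
  move=> cm e e0; have [s [Ss ms]] := cm _ (nbhsx_ballx m e e0).
  by exists s => //; move: ms; rewrite -ball_normE.
move=> H B /nbhs_ballP[e /= e0 eB]; have [s Ss ms] := H _ e0.
by exists s; split => //; apply: eB; rewrite -ball_normE.
Qed.

Lemma free_submod_closed : submod_closed free_pred.
Proof.
split; first by rewrite inE; apply: subset_closure; exact: lspan0.
move=> a u v /free_approx Hu /free_approx Hv; apply/free_approx => e e0.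
have a0 : 0 < `|a| + 1 by rewrite ltr_wpDl.
have [s Ss us] := Hu _ (divr_gt0 (divr_gt0 e0 (ltr0n _ 2)) a0).
have [t St vt] := Hv _ (divr_gt0 e0 (ltr0n _ 2)).
exists (a *: s + t); first by apply: lspanD => //; exact: lspanZ.
rewrite opprD addrACA -scalerBr (le_lt_trans (ler_normD _ _))// normrZ.
rewrite [ltRHS](splitr e) ler_ltD//.
rewrite ltr_pdivlMr// in us.
rewrite (le_trans _ (ltW us))// mulrC ler_wpM2l//.
by rewrite lerDl.
Qed.

HB.instance Definition _ :=
  GRing.isSubmodClosed.Build _ _ free_pred free_submod_closed.
HB.instance Definition _ := [SubChoice_isSubLmodule of lipfree by <:].

Definition free_norm (m : lipfree) : R := `|free_val m|.

Lemma free_normD m p : free_norm (m + p) <= free_norm m + free_norm p.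
Proof. exact: ler_normD. Qed.

Lemma free_normZ (l : R) m : free_norm (l *: m) = `|l| * free_norm m.
Proof. exact: normrZ. Qed.

Lemma free_norm_eq0 m : free_norm m = 0 -> m = 0.
Proof. by move=> /normr0_eq0 m0; exact/val_inj. Qed.

HB.instance Definition _ := Lmodule_isNormed.Build R lipfree
  free_normD free_normZ free_norm_eq0.

Lemma delta_free x : delta_dual x \in free_pred.
Proof.
by rewrite inE; apply: subset_closure; apply: sub_lspan; exists x.
Qed.

Definition delta (x : M) : lipfree := Free (delta_free x).

Lemma lipfree_dense (m : lipfree) (e : R) : 0 < e ->
  exists2 s, lspan (range delta) s & `|m - s| < e.
Proof.
move=> e0; have [s [n [c [a [Aa sE]]]] ms] :=
  (free_approx (free_val m)).1 (valP m) _ e0.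
have /choice[y yE] : forall i, exists y, delta_dual y = a i.
  by move=> i; have [y _ <-] := Aa i; exists y.
exists (\sum_(i < n) c i *: delta (y i)).
  by exists n, c, (delta \o y); split => // i; exists (y i).
suff sE' : free_val (\sum_(i < n) c i *: delta (y i)) = s.
  by rewrite -sE' in ms; exact: ms.
rewrite -[LHS]/(val _) raddf_sum sE.
by apply: eq_bigr => i _; rewrite -yE.
Qed.

End lipfree.

Section free_map.
Context {R : realType} {M : metricType R} {o : M} {f : M -> M}.
Hypotheses (lipf : lipschitz_map f) (f0 : f o = o).

Definition is_free_map (T : lipfree o -> lipfree o) :=
  [/\ linear T, exists K : R, forall m, `|T m| <= K * `|m|
    & forall x, T (delta o x) = delta o (f x)].

Let lipf_const : exists2 L : R, 0 <= L &
  forall x y, mdist (f x) (f y) <= L * mdist x y.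
Proof.
have [K HK] := lipf; exists `|K| => // x y; apply: le_trans (HK x y) _.
by apply: ler_wpM2r; [exact: mdist_ge0|exact: ler_norm].
Qed.

Let pull_subproof (phi : lip0 o) : (phi \o f : M -> R^o) \in lip0_pred o.
Proof.
rewrite inE; split; last by rewrite /= f0 (lip0P phi).2.
have [L L0 HL] := lipf_const; exists (lip0_norm phi * L) => x y.
rewrite {1}/mdist/= (le_trans (lip0_normP phi _ _))// -mulrA.
by rewrite ler_wpM2l ?lip0_norm_ge0// metric_sym.
Qed.

Let pull (phi : lip0 o) : lip0 o := Lip0 (pull_subproof phi).

Let pull_linear : linear pull.
Proof. by move=> a u v; apply/val_inj. Qed.

Let pull_norm : exists2 L : R, 0 <= L & forall phi, `|pull phi| <= L * `|phi|.
Proof.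
have [L L0 HL] := lipf_const; exists L => // phi.
apply: lip0_norm_le => [|x y]; first by rewrite mulr_ge0.
rewrite (le_trans (lip0_normP phi _ _))// mulrAC [leRHS]mulrC.
by rewrite ler_wpM2l ?lip0_norm_ge0.
Qed.

Lemma free_map_uniq T1 T2 : is_free_map T1 -> is_free_map T2 -> T1 = T2.
Proof.
move=> [l1 [K1 H1] d1] [l2 [K2 H2] d2].
pose A1 := GRing.isLinear.Build R (lipfree o) (lipfree o) _ T1 l1.
pose S1 : {linear lipfree o -> lipfree o} := HB.pack T1 A1.
pose A2 := GRing.isLinear.Build R (lipfree o) (lipfree o) _ T2 l2.
pose S2 : {linear lipfree o -> lipfree o} := HB.pack T2 A2.
have S12 s : lspan (range (delta o)) s -> S1 s = S2 s.
  move=> [n [c [a [Aa ->]]]]; rewrite !linear_sum; apply: eq_bigr => i _.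
  by rewrite !linearZ/=; have [y _ <-] := Aa i; rewrite d1 d2.
apply/funext => m; apply/eqP; rewrite -subr_eq0 -normr_le0.
apply/ler_addgt0Pl => e e0; rewrite addr0.
have K0 : 0 < `|K1 + K2| + 1 by rewrite ltr_wpDl.
have [s Ss ms] := lipfree_dense m (divr_gt0 e0 K0).
rewrite (_ : _ - _ = S1 (m - s) - S2 (m - s)); last first.
  by rewrite (linearB S1) (linearB S2) (S12 s Ss) opprB addrA subrK.
rewrite (le_trans (ler_normB _ _))// (le_trans (lerD (H1 _) (H2 _)))//.
rewrite -mulrDl; rewrite ltr_pdivlMr// mulrC in ms.
by rewrite (le_trans _ (ltW ms))// ler_wpM2r// ler_wpDr// ler_norm.
Qed.

Let push_subproof (m : dual_space (lip0 o)) :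
  (m \o pull : lip0 o -> R^o) \in dual_pred (V := lip0 o).
Proof.
have [L L0 HL] := pull_norm.
apply: (@bounded_dual_pred _ _ _ (dual_norm m * L)) => [a u v|phi].
  by rewrite /= pull_linear linearP.
rewrite /= (le_trans (dual_normP m _))// -mulrA.
by rewrite ler_wpM2l ?dual_norm_ge0.
Qed.

Let push (m : dual_space (lip0 o)) := Dual (push_subproof m).

Let push_linear : linear push.
Proof. by move=> a u v; apply/val_inj. Qed.

Let push_delta x : push (delta_dual o x) = delta_dual o (f x).
Proof. exact/val_inj. Qed.

Let push_norm : exists2 L : R, 0 <= L & forall m, `|push m| <= L * `|m|.
Proof.
have [L L0 HL] := pull_norm; exists L => // m.
apply: dual_norm_le => [|phi]; first by rewrite mulr_ge0.
rewrite (le_trans (dual_normP m _))// mulrAC mulrC.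
by rewrite ler_wpM2r ?dual_norm_ge0.
Qed.

Let push_free (m : lipfree o) : push (free_val m) \in free_pred (o := o).
Proof.
pose A := GRing.isLinear.Build R (dual_space (lip0 o)) (dual_space (lip0 o)) _
  push push_linear.
pose P : {linear dual_space (lip0 o) -> dual_space (lip0 o)} := HB.pack push A.
have [L L0 HL] := push_norm.
have L1 : 0 < L + 1 by rewrite ltr_wpDl.
apply/free_approx => e e0.
have [s [n [c [a [Aa sE]]]] ms] :=
  (free_approx (free_val m)).1 (valP m) _ (divr_gt0 e0 L1).
exists (P s).
  exists n, c, (P \o a); split.
    move=> i; have [y _ yE] := Aa i; exists (f y) => /=; first by [].
    by rewrite -yE push_delta.
  by rewrite sE linear_sum; apply: eq_bigr => i _; rewrite linearZ.
rewrite -[X in X - _]/(P _) -linearB (le_lt_trans (HL _))//.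
rewrite ltr_pdivlMr// mulrC in ms.
by rewrite (le_lt_trans _ ms)// ler_wpM2r// lerDl.
Qed.

Lemma free_map_exists : exists T, is_free_map T.
Proof.
pose T (m : lipfree o) : lipfree o := Free (push_free m).
have lT : linear T by move=> a u v; apply/val_inj; exact: push_linear.
exists T; split; [by []| |by move=> x; apply/val_inj; exact: push_delta].
by have [L L0 HL] := push_norm; exists L => m; exact: HL.
Qed.

(* The unique map characterized by [is_free_map] (see [free_map_uniq]). *)
Definition free_map : lipfree o -> lipfree o := sval (cid free_map_exists).

Lemma free_mapP : is_free_map free_map.
Proof. exact: svalP. Qed.

End free_map.

(* Main.v *)
(* If the orbit of x is dense, then, since |delta y - delta z| <= d(y, z), the
   span of the vectors delta (f^n x) is dense in the span of all the deltas.
   Conversely, if the orbit misses a nonempty open set, it also misses a ball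
   B(y, r) avoiding the base point, because the latter is not isolated; the
   function z |-> max (r - d(y, z)) 0 of Lip_0 is then a functional on the free
   space which kills the cyclic subspace of delta x but not delta y. *)
Require Import Defs.
From HB Require Import structures.
From mathcomp Require Import all_boot all_order all_algebra.
From mathcomp Require Import all_classical all_reals all_analysis.
Import Order.TTheory GRing.Theory Num.Theory.
Import numFieldNormedType.Exports.

Local Open Scope classical_set_scope.
Local Open Scope ring_scope.

Section dense.
Context {R : realType}.

Lemma metric_denseP {M : metricType R} (A : set M) :
  dense A <-> forall y (e : R), 0 < e -> exists2 a, A a & mdist y a < e.
Proof.
split=> [dA y e e0|dA U [y Uy] oU].
  have [|a [/interior_subset ya Aa]] :=
      dA (ball y e)° _ (open_interior _).
    by exists y; exact: nbhsx_ballx.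
  by exists a => //; move: ya; rewrite ballEmdist.
have /nbhs_ballP[e e0 eU] : nbhs y U by exact: open_nbhs_nbhs.
have [a Aa ya] := dA y e e0.
by exists a; split => //; apply: eU; rewrite ballEmdist.
Qed.

Lemma normed_denseP {V : normedModType R} (A : set V) :
  dense A <-> forall v (e : R), 0 < e -> exists2 a, A a & `|v - a| < e.
Proof.
split=> [dA v e e0|dA U [v Uv] oU].
  have [|a [/interior_subset va Aa]] :=
      dA (ball v e)° _ (open_interior _).
    by exists v; exact: nbhsx_ballx.
  by exists a => //; move: va; rewrite -ball_normE.
have /nbhs_ballP[e e0 eU] : nbhs v U by exact: open_nbhs_nbhs.
have [a Aa va] := dA v e e0.
by exists a; split => //; apply: eU; rewrite -ball_normE.
Qed.

(** A nonempty open set disjoint from [[set~ o]] can only be [{o}], which would isolate [o]. *)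
Lemma nonisolated_dense_setC1 {M : metricType R} (o : M) :
  ~ isolated [set: M] o -> dense [set~ o].
Proof.
move=> iso U [y Uy] oU; apply/set0P/eqP => U0; apply: iso.
have Uo z : U z -> z = o.
  by move=> Uz; apply: contrapT => zo; have : set0 z by rewrite -U0.
have Eo : U o by rewrite -(Uo _ Uy).
split; first exact: in_setT.
exists U; first exact: open_nbhs_nbhs.
by apply/seteqP; split => [z [/Uo]//|z ->].
Qed.

End dense.

Section tent.
Context {R : realType} {M : metricType R}.

Definition tent (y : M) (r : R) (z : M) : R^o := Num.max (r - mdist y z) 0.

Lemma tent_out (y : M) r z : r <= mdist y z -> tent y r z = 0.
Proof. by move=> yz; apply/max_idPr; rewrite subr_le0. Qed.

Lemma tent_center (y : M) r : 0 <= r -> tent y r y = r.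
Proof. by move=> r0; rewrite /tent mdistxx subr0; exact/max_idPl. Qed.

(** By the triangle inequality [r - mdist y z] is 1-Lipschitz in [z], and truncation at 0 preserves
    this. *)
Lemma tent_lipschitz (y : M) r : lipschitz_map (tent y r).
Proof.
exists 1 => a b; rewrite mul1r {1}/mdist/= /tent.
have H : forall a b, r - mdist y b <= r - mdist y a + mdist a b.
  move=> {}a {}b; rewrite -addrA lerD2l lerNl opprD opprK lerBlDr.
  by rewrite (metric_sym a b); exact: metric_triangle.
have := H a b; have := H b a; rewrite (metric_sym b a).
have : 0 <= mdist a b by exact: mdist_ge0.
move: (mdist a b) (r - mdist y a) (r - mdist y b) => d p q d0 pq qp.
have max_le (u v : R) : u <= v + d -> Num.max u 0 <= Num.max v 0 + d.
  move=> uv; rewrite ge_max (le_trans uv) ?lerD2r ?le_max ?lexx//=.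
  by rewrite addr_ge0// le_max lexx orbT.
by rewrite ler_norml lerNl opprB !lerBlDr ![d + _]addrC !max_le.
Qed.

End tent.

Section free.
Context {R : realType} {M : metricType R} {o : M}.

Lemma delta_dist (y z : M) : `|delta o y - delta o z| <= mdist y z.
Proof.
apply: dual_norm_le => [|phi]; first exact: mdist_ge0.
by rewrite mulrC; exact: (lip0_normP phi y z).
Qed.

Lemma lipfree_pairing (m : lipfree o) (phi : lip0 o) :
  `|free_val m phi| <= `|m| * `|phi|.
Proof. exact: dual_normP. Qed.

(** Pairing with [phi] is linear on the free space, so its kernel is a subspace. *)
Lemma lspan_annihilated (A : set (lipfree o)) (phi : lip0 o) :
  (forall a, A a -> free_val a phi = 0) ->
  forall s, lspan A s -> free_val s phi = 0.
Proof.
move=> A0 _ [n [c [a [Aa ->]]]].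
elim/big_rec : _ => [//|i s _ s0].
transitivity (c i *: free_val (a i) phi + free_val s phi); first by [].
by rewrite A0// s0 addr0; exact: mulr0.
Qed.

Lemma dense_lspan_delta {D : set M} : dense D ->
  dense (lspan [set delta o y | y in D]).
Proof.
move=> /metric_denseP dD; apply/normed_denseP => m e e0.
(* Half of [e] pays for replacing [m] by a combination of deltas, the other half for moving its
   points into [D]. *)
have e20 : 0 < e / 2 by rewrite divr_gt0.
have [_ [n [c [a [Aa ->]]]] ms] := lipfree_dense m e20.
(* The [+ 1] keeps the divisor positive even if all coefficients vanish. *)
have S0 : 0 < \sum_(i < n) `|c i| + 1 by rewrite ltr_wpDl// sumr_ge0.
have /choice[y Hy] : forall i, exists y, D y /\
    `|a i - delta o y| <= e / 2 / (\sum_(i < n) `|c i| + 1).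
  move=> i; have [z _ <-] := Aa i.
  have [y Dy zy] := dD z _ (divr_gt0 e20 S0).
  by exists y; split => //; rewrite (le_trans (delta_dist _ _))// ltW.
exists (\sum_(i < n) c i *: delta o (y i)).
  exists n, c, (fun i => delta o (y i)); split => // i.
  by exists (y i) => //; exact: (Hy i).1.
rewrite (splitr e) (le_lt_trans (ler_distD (\sum_(i < n) c i *: a i) _ _))//.
rewrite ltr_leD// -sumrB (le_trans (ler_norm_sum _ _ _))//.
have : forall i, true -> `|c i *: a i - c i *: delta o (y i)| <=
    `|c i| * (e / 2 / (\sum_(i < n) `|c i| + 1)).
  by move=> i _; rewrite -scalerBr normrZ ler_wpM2l//; exact: (Hy i).2.
move=> /ler_sum/le_trans; apply.
by rewrite -mulr_suml mulrCA ler_piMr ?(ltW e20)// ler_pdivrMr// mul1r lerDl.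
Qed.

Lemma lspan_delta_dense {D : set M} : ~ isolated [set: M] o ->
  dense (lspan [set delta o y | y in D]) -> dense D.
Proof.
move=> iso /normed_denseP dD; apply/metric_denseP => y0 e e0.
apply: contrapT => De.
have e20 : 0 < e / 2 by rewrite divr_gt0.
(* The centre [y0] may be [o] itself, where every function of Lip_0 vanishes; non-isolation provides
   a nearby [y] other than [o]. *)
have [y yo y0y] := (metric_denseP _).1 (nonisolated_dense_setC1 o iso) y0 _ e20.
(* The bound [e / 2] keeps the ball of radius [r] about [y] inside the ball of radius [e] about
   [y0], hence off [D]; the bound [mdist y o] makes the tent vanish at [o]. *)
pose r := Num.min (e / 2) (mdist y o).
have r0 : 0 < r by rewrite lt_min e20 mdist_gt0; exact/eqP.
have tent_lip0 : tent y r \in lip0_pred o.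
  rewrite inE; split; first exact: tent_lipschitz.
  by apply: tent_out; rewrite ge_min lexx orbT.
pose phi : lip0 o := Lip0 tent_lip0.
have kill s : lspan [set delta o z | z in D] s -> free_val s phi = 0.
  apply: lspan_annihilated => _ [z Dz <-]; apply: tent_out.
  rewrite ge_min; apply/orP; left; rewrite leNgt; apply/negP => yz.
  apply: De; exists z => //.
  by rewrite (splitr e) (le_lt_trans (metric_triangle _ y _))// ltrD.
have p0 : 0 < `|phi| + 1 by rewrite ltr_wpDl.
have [s Ds] := dD (delta o y) _ (divr_gt0 r0 p0).
rewrite ltr_pdivlMr// ltNge => /negP; apply.
rewrite (@le_trans _ _ (`|delta o y - s| * `|phi|))//; last first.
  by rewrite ler_wpM2l// lerDl.
rewrite (le_trans _ (lipfree_pairing _ _))//.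
have -> : free_val (delta o y - s) phi = tent y r y - free_val s phi by [].
by rewrite kill// subr0 (tent_center _ _ (ltW r0)) ler_norm.
Qed.

End free.

Lemma iter_free_map {R : realType} {M : metricType R} {o : M} {f : M -> M}
    (lipf : lipschitz_map f) (f0 : f o = o) n x :
  iter n (free_map lipf f0) (delta o x) = delta o (iter n f x).
Proof.
have [_ _ fd] := free_mapP lipf f0.
by elim: n => //= n ->; rewrite fd.
Qed.

Theorem proposition2p7 (R : realType) (M : metricType R) (o : M)
    (o_nonisolated : ~ isolated [set: M] o)
    (f : M -> M) (lipf : lipschitz_map f) (f0 : f o = o) (x : M) :
  hypercyclic_element f x <->
  @cyclic_vector R (lipfree o) (free_map lipf f0) (delta o x).
Proof.
(* The orbit of [delta o x] is the image under [delta o] of the orbit of [x], so both directions are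
   the density lemmas with [D] that orbit. *)
have orbitE : [set iter n (free_map lipf f0) (delta o x) | n in [set: nat]] =
    [set delta o y | y in [set iter n f x | n in [set: nat]]].
  by rewrite image_comp; apply: eq_imagel => n _; exact: iter_free_map.
rewrite /cyclic_vector orbitE; split; first exact: dense_lspan_delta.
exact: lspan_delta_dense.
Qed.
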